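(* If $0\neq\Omega\in\mathcal{SP}_1$ is a (nonzero) superpositive map on $\mathcal{L}(\mathcal{H}_n)$, then $\mathcal{M}_{\{\Omega\}}=\mathcal{SP}_1$.
   Context: $\mathcal{H}_n$ is an $n$-dimensional complex Hilbert space and $\mathcal{L}(\mathcal{H}_n)$ is the space of linear operators on it. A linear map $\Phi:\mathcal{L}(\mathcal{H}_n)\to\mathcal{L}(\mathcal{H}_n)$ is positive if $\Phi(X)\ge 0$ whenever $X\ge 0$ (positive semidefinite), and completely positive if $id_k\otimes\Phi$ is positive for every $k\in\mathbb{N}$, where $id_k$ is the identity map on $\mathcal{L}(\mathcal{H}_k)$. $\mathcal{P}_1$ and $\mathcal{CP}$ denote the sets of positive and completely positive maps on $\mathcal{L}(\mathcal{H}_n)$. For $A\in\mathcal{L}(\mathcal{H}_n)$, ${\rm Ad}_A(X)=AXA^*$. $\mathcal{SP}_1$ is the set of superpositive maps: those of the form $\sum_i{\rm Ad}_{A_i}$ (finite sum) with ${\rm rank}(A_i)\le 1$ for all $i$. For $\mathcal{Q}\subset\mathcal{P}_1$, the convex mapping cone generated by $\mathcal{Q}$ is $\mathcal{M}_{\mathcal{Q}}:=\{\sum_i\Phi_i\circ\Omega_i\circ\Psi_i:\Omega_i\in\mathcal{Q},\ \Phi_i,\Psi_i\in\mathcal{CP}\ \forall i\}$ (finite sums). *)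

(* Defs.v *)
From HB Require Import structures.
From mathcomp Require Import all_boot all_order all_algebra.
From mathcomp Require Import classical_sets reals.
From mathcomp Require Import complex mxtens.
Set Implicit Arguments.
Unset Strict Implicit.
Unset Printing Implicit Defensive.

Import Order.TTheory GRing.Theory Num.Theory.
Local Open Scope ring_scope.
Local Open Scope classical_set_scope.
Local Open Scope sesquilinear_scope.

(** The [n]-dimensional Hilbert space is the space of column vectors
    ['cV[C]_n] with the standard inner product, operators on it are matrices
    ['M[C]_n], and linear maps on operators are elements of
    ['End('M[C]_n)], so that their sums, their composition [\o%VF], their zero
    and their equality are those of the library. The adjoint of [A] is
    [A ^t*]. *)

(** In a [numClosedFieldType], [0 <= z] says that [z] is real and nonnegative;
    hence this condition already forces [X] to be Hermitian. *)
Definition psdmx (C : numClosedFieldType) (n : nat) (X : 'M[C]_n) : Prop :=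
  forall v : 'cV[C]_n, 0 <= (v ^t* *m X *m v) 0 0.

Definition positive_maps (C : numClosedFieldType) (n : nat) :
    set 'End('M[C]_n) :=
  [set Phi | forall X : 'M[C]_n, psdmx X -> psdmx (Phi X)].

(** Tensor product of two linear maps on operators. The operators on
    [C^k (x) C^n] are the matrices of size [k * n], with basis the Kronecker
    products [delta_mx i j *t delta_mx a b]; the coefficient of [X] on this
    basis vector is [X (mxtens_index (i, a)) (mxtens_index (j, b))]. The lemma
    [tens_mapE] below is the characteristic property. *)
Definition tens_map_fun (C : numClosedFieldType) (k n : nat)
    (F : 'End('M[C]_k)) (G : 'End('M[C]_n)) (X : 'M[C]_(k * n)) :
    'M[C]_(k * n) :=
  \sum_(i < k) \sum_(j < k) \sum_(a < n) \sum_(b < n)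
    X (mxtens_index (i, a)) (mxtens_index (j, b))
      *: (F (delta_mx i j) *t G (delta_mx a b)).

Lemma tens_map_fun_linear (C : numClosedFieldType) (k n : nat)
    (F : 'End('M[C]_k)) (G : 'End('M[C]_n)) : linear (tens_map_fun F G).
Proof.
move=> c X Y; rewrite /tens_map_fun.
do 4 (rewrite scaler_sumr -big_split; apply: eq_bigr => ? _ /=).
by rewrite !mxE scalerDl scalerA.
Qed.

HB.instance Definition _ (C : numClosedFieldType) (k n : nat)
    (F : 'End('M[C]_k)) (G : 'End('M[C]_n)) :=
  GRing.isLinear.Build C 'M[C]_(k * n) 'M[C]_(k * n) _ (tens_map_fun F G)
    (tens_map_fun_linear F G).

Definition tens_map (C : numClosedFieldType) (k n : nat)
    (F : 'End('M[C]_k)) (G : 'End('M[C]_n)) : 'End('M[C]_(k * n)) :=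
  linfun (tens_map_fun F G).

Lemma tens_mapE (C : numClosedFieldType) (k n : nat)
    (F : 'End('M[C]_k)) (G : 'End('M[C]_n)) (A : 'M[C]_k) (B : 'M[C]_n) :
  tens_map F G (A *t B) = F A *t G B.
Proof.
have tmxDl p q r s (U V : 'M[C]_(p, q)) (W : 'M[C]_(r, s)) c :
  (c *: U + V) *t W = c *: (U *t W) + V *t W.
  by apply/matrixP=> i j; rewrite !mxE mulrDl mulrA.
have tmxDr p q r s (U V : 'M[C]_(p, q)) (W : 'M[C]_(r, s)) c :
  W *t (c *: U + V) = c *: (W *t U) + W *t V.
  by apply/matrixP=> i j; rewrite !mxE mulrDr mulrCA.
rewrite lfunE /= /tens_map_fun.
have tmx_suml I (r : seq I) (U : I -> 'M[C]_k) (W : 'M[C]_n) :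
  (\sum_(i <- r) U i) *t W = \sum_(i <- r) U i *t W.
  elim: r => [|i r IH]; first by rewrite !big_nil tens0mx.
  by rewrite !big_cons -{1}[U i]scale1r tmxDl IH scale1r.
have tmx_sumr I (r : seq I) (U : I -> 'M[C]_n) (W : 'M[C]_k) :
  W *t (\sum_(i <- r) U i) = \sum_(i <- r) W *t U i.
  elim: r => [|i r IH]; first by rewrite !big_nil tensmx0.
  by rewrite !big_cons -{1}[U i]scale1r tmxDr IH scale1r.
have tmxZZ c d (U : 'M[C]_k) (V : 'M[C]_n) :
  (c *: U) *t (d *: V) = (c * d) *: (U *t V).
  by apply/matrixP=> i j; rewrite !mxE mulrACA.
transitivity (F (\sum_i \sum_j A i j *: delta_mx i j)
              *t G (\sum_i \sum_j B i j *: delta_mx i j)); last first.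
  by rewrite -!matrix_sum_delta.
rewrite linear_sum tmx_suml; apply: eq_bigr => i _.
rewrite linear_sum tmx_suml; apply: eq_bigr => j _.
rewrite linear_sum tmx_sumr; apply: eq_bigr => a _.
rewrite linear_sum tmx_sumr; apply: eq_bigr => b _.
by rewrite !linearZ tmxZZ tensmxE.
Qed.

Definition completely_positive_maps (C : numClosedFieldType) (n : nat) :
    set 'End('M[C]_n) :=
  [set Phi | forall k : nat,
     @positive_maps C (k * n) (tens_map (\1%VF : 'End('M[C]_k)) Phi)].

Definition Ad (C : numClosedFieldType) (n : nat) (A : 'M[C]_n) :
    'End('M[C]_n) :=
  linfun (mulmxr (A ^t*) \o mulmx A).

Lemma AdE (C : numClosedFieldType) (n : nat) (A X : 'M[C]_n) :
  Ad A X = A *m X *m A ^t*.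
Proof. by rewrite lfunE. Qed.

Definition superpositive_maps (C : numClosedFieldType) (n : nat) :
    set 'End('M[C]_n) :=
  [set Phi | exists (m : nat) (A : 'I_m -> 'M[C]_n),
     (forall i, (\rank (A i) <= 1)%N) /\ Phi = \sum_(i < m) Ad (A i)].

(** The convex mapping cone generated by [Q]; it is meant for
    [Q `<=` positive_maps]. *)
Definition mapping_cone (C : numClosedFieldType) (n : nat)
    (Q : set 'End('M[C]_n)) : set 'End('M[C]_n) :=
  [set Theta | exists (m : nat) (Phi Omega Psi : 'I_m -> 'End('M[C]_n)),
     [/\ forall i, Q (Omega i),
         forall i, completely_positive_maps (Phi i),
         forall i, completely_positive_maps (Psi i)
       & Theta = \sum_(i < m) (Phi i \o Omega i \o Psi i)%VF]].

(* Main.v *)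
(** If [A = u v^*] has rank one and [Phi], [Psi] are positive, then
    [Phi o Ad_A o Psi] maps [X] to [f(X) Y] with [f(X) = v^* Psi(X) v] a positive
    functional and [Y = Phi(u u^* ) >= 0]. Writing [f(X) = sum_l z_l^* X z_l] and
    [Y = sum_k w_k w_k^*] exhibits it as the sum of the [Ad_(w_k z_l^* )]. So the
    cone is contained in the superpositive maps.

    Conversely, a nonzero [Omega = sum_i Ad_(A_i)] has some
    [s = <e_p, Omega(e_q e_q^* ) e_p> > 0], and then
    [Ad_(u e_p^* ) o Omega o Ad_(e_q v^* ) = s Ad_(u v^* )] for all [u], [v]. *)
Require Import Defs.
From mathcomp Require Import all_boot all_order all_algebra.
From mathcomp Require Import classical_sets reals.
From mathcomp Require Import complex mxtens.
Import Order.TTheory GRing.Theory Num.Theory.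
Local Open Scope ring_scope.
Local Open Scope classical_set_scope.
Local Open Scope complex_scope.
Local Open Scope sesquilinear_scope.

Section Superpositive.
Set Implicit Arguments.
Unset Strict Implicit.
Variable C : numClosedFieldType.

(** * Adjoints and positive semidefinite matrices *)

Lemma tmxCM (m n p : nat) (A : 'M[C]_(m, n)) (B : 'M[C]_(n, p)) :
  (A *m B) ^t* = B ^t* *m A ^t*.
Proof. by rewrite trmx_mul map_mxM. Qed.

Lemma tmxCD (m n : nat) (A B : 'M[C]_(m, n)) : (A + B) ^t* = A ^t* + B ^t*.
Proof. by rewrite !raddfD. Qed.

Lemma tmxCZ (m n : nat) (c : C) (A : 'M[C]_(m, n)) :
  (c *: A) ^t* = Num.conj c *: A ^t*.
Proof. by rewrite linearZ /= map_mxZ. Qed.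

Lemma tmxC_tens (m n p q : nat) (A : 'M[C]_(m, n)) (B : 'M[C]_(p, q)) :
  (A *t B) ^t* = A ^t* *t B ^t*.
Proof. by rewrite trmx_tens map_mxT. Qed.

Lemma mul_row_adj_ge0 (n : nat) (w : 'rV[C]_n) : 0 <= (w *m w ^t*) 0 0.
Proof. by rewrite mxE sumr_ge0 // => i _; rewrite !mxE mul_conjC_ge0. Qed.

Lemma psdmx_mul_adj (m n : nat) (W : 'M[C]_(n, m)) : psdmx (W *m W ^t*).
Proof.
move=> v; rewrite mulmxA -mulmxA -[X in _ *m X]trmxCK tmxCM trmxCK.
exact: mul_row_adj_ge0.
Qed.

Lemma psdmx_conj (m n : nat) (V : 'M[C]_(m, n)) (X : 'M[C]_n) :
  psdmx X -> psdmx (V *m X *m V ^t*).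
Proof.
move=> Xpsd v; have := Xpsd (V ^t* *m v).
by rewrite tmxCM trmxCK !mulmxA.
Qed.

(** Polarization over the complex numbers: the form at [u + w] and at [u + 'i *: w] recovers every
    sesquilinear value, in particular the matrix entries. *)
Lemma quadratic_form_eq0 (n : nat) (Y : 'M[C]_n) :
  (forall v : 'cV[C]_n, v ^t* *m Y *m v = 0) -> Y = 0.
Proof.
move=> q0.
have polar (u w : 'cV[C]_n) : u ^t* *m Y *m w + w ^t* *m Y *m u = 0.
  have := q0 (u + w); rewrite tmxCD !mulmxDl !mulmxDr !q0.
  by rewrite add0r addr0.
have sesq0 (u w : 'cV[C]_n) : u ^t* *m Y *m w = 0.
  (* Conjugating ['i] flips one sign, so this instance says that the two terms of [polar u w] are
     equal; as they also sum to 0, both vanish. *)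
  have e1 := polar u w; have := polar u ('i *: w).
  rewrite tmxCZ -!scalemxAl -scalemxAr conjCi scaleNr -scalerBr.
  move=> /eqP; rewrite scaler_eq0 (negbTE (neq0Ci _)) /= subr_eq0 => /eqP e2.
  move: e1; rewrite -e2 -mulr2n -scaler_nat => /eqP.
  by rewrite scaler_eq0 pnatr_eq0 => /eqP.
apply/matrixP=> i j; have /matrixP/(_ 0 0) := sesq0 (delta_mx i 0) (delta_mx j 0).
by rewrite trmx_delta map_delta_mx -rowE -colE !mxE.
Qed.

(** The form of [X ^t*] is the conjugate of the form of [X], which is real because it is
    nonnegative; hence the form of the difference vanishes. *)
Lemma psdmx_hermitian (n : nat) (X : 'M[C]_n) : psdmx X -> X ^t* = X.
Proof.
move=> Xpsd; apply/eqP; rewrite -subr_eq0; apply/eqP/quadratic_form_eq0 => v.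
rewrite mulmxBr mulmxBl; apply/eqP; rewrite subr_eq0; apply/eqP.
have -> : v ^t* *m X ^t* *m v = (v ^t* *m X *m v) ^t*.
  by rewrite !tmxCM trmxCK mulmxA.
apply/matrixP=> i j; rewrite !ord1 !mxE; apply/CrealP/ger0_real.
by have := Xpsd v; rewrite mxE.
Qed.

Lemma psdmx_factor (n : nat) (X : 'M[C]_n) :
  psdmx X -> exists W : 'M[C]_n, X = W *m W ^t*.
Proof.
move=> Xpsd; have Xn : X \is normalmx.
  by apply/normalmxP; rewrite psdmx_hermitian.
have Pu := spectral_unitarymx X; have /orthomx_spectralP := Xn.
set P := spectralmx X in Pu *; set d := spectral_diag X.
rewrite (invmx_unitary Pu) => eX.
(* Each eigenvalue is the form of the diagonalized matrix [P *m X *m P ^t*] at a basis vector, so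
   [d] has nonnegative square roots. *)
have d_ge0 i : 0 <= d 0 i.
  have := psdmx_conj P Xpsd (delta_mx i 0).
  have -> : P *m X *m P ^t* = diag_mx d.
    by rewrite {1}eX !mulmxA (unitarymxP Pu) mul1mx mulmxtVK.
  rewrite trmx_delta map_delta_mx -rowE -colE !mxE eqxx.
  by rewrite mulr1n.
exists (P ^t* *m diag_mx (map_mx sqrtC d)).
rewrite tmxCM trmxCK !mulmxA -[X in X *m P]mulmxA {1}eX.
rewrite tr_diag_mx map_diag_mx mulmx_diag; congr (_ *m diag_mx _ *m _).
apply/rowP=> i; rewrite !mxE /=.
by rewrite (CrealP (ger0_real _)) ?sqrtC_ge0 // -expr2 sqrtCK.
Qed.

(** * Operators of rank at most one and their [Ad] maps *)

Lemma rank_le1_factor (m n : nat) (A : 'M[C]_(m, n)) :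
  (\rank A <= 1)%N -> exists u : 'cV[C]_m, exists v : 'cV[C]_n, A = u *m v ^t*.
Proof.
have := mulmx_base A; move: (row_base A) (col_base A).
move: (\rank A) => [|[|//]] r c <- _.
  by exists 0, 0; rewrite mul0mx [r]flatmx0 mulmx0.
by exists c, (r ^t*); rewrite trmxCK.
Qed.

Lemma rank_le1_mul (m n : nat) (u : 'cV[C]_m) (v : 'rV[C]_n) :
  (\rank (u *m v) <= 1)%N.
Proof. exact: leq_trans (mxrankM_maxl _ _) (rank_leq_col _). Qed.

Lemma AdZ (n : nat) (c : C) (A : 'M[C]_n) :
  Ad (c *: A) = (c * Num.conj c) *: Ad A.
Proof.
apply/lfunP=> X; rewrite scale_lfunE !AdE tmxCZ.
by rewrite -scalemxAl -scalemxAr -scalemxAl scalerA mulrC.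
Qed.

Lemma Ad_rank1 (n : nat) (u v : 'cV[C]_n) (X : 'M[C]_n) :
  Ad (u *m v ^t*) X = (v ^t* *m X *m v) 0 0 *: (u *m u ^t*).
Proof.
have -> : Ad (u *m v ^t*) X = u *m (v ^t* *m X *m v) *m u ^t*.
  by rewrite AdE tmxCM trmxCK !mulmxA.
by rewrite {1}[_ *m v]mx11_scalar mul_mx_scalar -scalemxAl.
Qed.

(** Used to expand the trace of [Z ^t* *m X *m Z] into the values of the form of [X] at the columns
    of [Z]. *)
Lemma col_quadratic_form (n m : nat) (i : 'I_n) (Z : 'M[C]_(m, n)) (X : 'M[C]_m) :
  ((col i Z) ^t* *m X *m col i Z) 0 0 = (Z ^t* *m X *m Z) i i.
Proof.
rewrite colE tmxCM trmx_delta map_delta_mx !mulmxA -colE -!mulmxA -rowE.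
by rewrite !mxE.
Qed.

Lemma mul_tmxC_sum_col (m n p : nat) (W : 'M[C]_(m, p)) (Z : 'M[C]_(n, p)) :
  W *m Z ^t* = \sum_k col k W *m (col k Z) ^t*.
Proof.
apply/matrixP=> i j; rewrite mxE summxE; apply: eq_bigr => k _.
by rewrite !mxE big_ord1 !mxE.
Qed.

(** * Complete positivity *)

Lemma tens_sum_delta (k n : nat) (X : 'M[C]_(k * n)) :
  X = \sum_(i < k) \sum_(j < k) \sum_(a < n) \sum_(b < n)
    X (mxtens_index (i, a)) (mxtens_index (j, b))
      *: (delta_mx i j *t delta_mx a b).
Proof.
rewrite [LHS]matrix_sum_delta.
have reidx (V : zmodType) (F : 'I_(k * n) -> V) :
    \sum_p F p = \sum_(i < k) \sum_(a < n) F (mxtens_index (i, a)).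
  rewrite pair_bigA (reindex (@mxtens_index k n)) /=; last first.
    by exists (@mxtens_unindex k n) => p _; rewrite (mxtens_indexK, mxtens_unindexK).
  by apply: eq_bigr => -[].
rewrite reidx; apply: eq_bigr => i _.
under eq_bigr do rewrite reidx.
rewrite exchange_big; apply: eq_bigr => j _; apply: eq_bigr => a _.
apply: eq_bigr => b _; congr (_ *: _).
apply/matrixP=> p q; case: (mxtens_indexP p) => i' a'.
case: (mxtens_indexP q) => j' b'; rewrite tensmxE !mxE.
rewrite !(can_eq (@mxtens_indexK _ _)) !xpair_eqE -natrM mulnb.
by congr (_%:R); rewrite andbACA.
Qed.

(** By linearity it is enough to compare on the Kronecker basis, where the tensor product is
    multiplicative. Complete positivity of [Ad A] thereby reduces to [psdmx_conj]. *)
Lemma tens_map_Ad (k n : nat) (A : 'M[C]_n) (X : 'M[C]_(k * n)) :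
  tens_map \1%VF (Ad A) X = (1%:M *t A) *m X *m (1%:M *t A) ^t*.
Proof.
rewrite lfunE /= /tens_map_fun [in RHS](tens_sum_delta X).
do 4 (rewrite mulmx_sumr mulmx_suml; apply: eq_bigr => ? _).
rewrite -scalemxAr -scalemxAl tmxC_tens !tensmx_mul AdE id_lfunE.
by rewrite trmx1 map_mx1 mul1mx mulmx1.
Qed.

Lemma completely_positive_Ad (n : nat) (A : 'M[C]_n) :
  completely_positive_maps (Ad A).
Proof. by move=> k X Xpsd; rewrite tens_map_Ad; apply: psdmx_conj. Qed.

Lemma completely_positive_positive (n : nat) (Phi : 'End('M[C]_n)) :
  completely_positive_maps Phi -> positive_maps Phi.
Proof.
move=> /(_ 1%N) PhiP X /psdmx_factor[W ->] v.
(* The factorization of the argument passes to the tensor product with the 1 by 1 identity, which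
   moves it to size [1 * n]. *)
have psd1 : psdmx ((1%:M : 'M[C]_1) *t (W *m W ^t*)).
  have := psdmx_mul_adj ((1%:M : 'M[C]_1) *t W).
  by rewrite tmxC_tens tensmx_mul trmx1 map_mx1 mul1mx.
(* The test vector is moved to size [1 * n] in the same way; [1 * 1] computes to 1, so [w] is a
   column. *)
pose w : 'M[C]_(1 * n, 1 * 1) := 1%:M *t v.
have : 0 <= (w ^t* *m tens_map \1%VF Phi (1%:M *t (W *m W ^t*)) *m w) 0 0.
  exact: PhiP psd1 w.
rewrite tens_mapE id_lfunE tmxC_tens !tensmx_mul trmx1 map_mx1 !mul1mx.
by rewrite [X in _ <= X -> _]mxE !ord1 mxE mul1r.
Qed.

(** * Superpositive maps: sums over arbitrary finite index types, and compositions with positive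
    maps *)

Lemma superpositive_sum (n : nat) (I : finType) (A : I -> 'M[C]_n) :
  (forall i, (\rank (A i) <= 1)%N) -> superpositive_maps (\sum_i Ad (A i)).
Proof.
move=> rkA; exists #|I|, (A \o enum_val); split=> [i|]; first exact: rkA.
rewrite (reindex_onto enum_rank enum_val) => [|i _]; last exact: enum_valK.
by apply: eq_big => [i|i _] /=; rewrite enum_rankK // eqxx.
Qed.

Lemma superpositive_add (n : nat) (Phi Psi : 'End('M[C]_n)) :
  superpositive_maps Phi -> superpositive_maps Psi ->
  superpositive_maps (Phi + Psi).
Proof.
move=> [p [A [rkA ->]]] [q [B [rkB ->]]].
pose D (s : 'I_p + 'I_q) := match s with inl i => A i | inr j => B j end.
have -> : \sum_i Ad (A i) + \sum_j Ad (B j) = \sum_s Ad (D s).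
  by rewrite big_sumType.
by apply: superpositive_sum => -[].
Qed.

Lemma superpositive_bigsum (n : nat) (I : finType) (F : I -> 'End('M[C]_n)) :
  (forall i, superpositive_maps (F i)) -> superpositive_maps (\sum_i F i).
Proof.
move=> spF; apply: big_ind => //; last by move=> *; apply: superpositive_add.
by exists 0%N, (fun=> 0); split=> [i|]; rewrite ?mxrank0 // big_ord0.
Qed.

(* The functional [X |-> v^* Psi(X) v] is positive, so its density matrix [M]
   is psd and factors as [Z Z^* ], which turns it into [\tr (Z^* X Z)]. *)
Lemma superpositive_comp_Ad (n : nat) (Phi Psi : 'End('M[C]_n)) (A : 'M[C]_n) :
  positive_maps Phi -> positive_maps Psi -> (\rank A <= 1)%N ->
  superpositive_maps (Phi \o Ad A \o Psi)%VF.
Proof.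
move=> PhiP PsiP /rank_le1_factor[u [v ->]].
have [W eW] := psdmx_factor (PhiP _ (psdmx_mul_adj u)).
pose f X : C := (v ^t* *m Psi X *m v) 0 0.
have f_sum X : f X = \sum_i \sum_j X i j * f (delta_mx i j).
  rewrite /f {1}[X]matrix_sum_delta !linear_sum mulmx_suml summxE /=.
  apply: eq_bigr => i _.
  rewrite !linear_sum mulmx_suml summxE /=; apply: eq_bigr => j _.
  by rewrite !linearZ /= -scalemxAl mxE.
(* The indices are swapped so that [f X] is the trace of [X *m M], without a transpose. *)
pose M : 'M[C]_n := \matrix_(i, j) f (delta_mx j i).
have fE X : f X = \tr (X *m M).
  rewrite f_sum; apply: eq_bigr => i _; rewrite mxE; apply: eq_bigr => j _.
  by rewrite [M _ _]mxE.
have [Z eZ] : exists Z : 'M[C]_n, M = Z *m Z ^t*.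
  apply: psdmx_factor => z.
  (* The form of [M] at [z] is [f] at a positive semidefinite matrix, hence nonnegative. *)
  have -> : (z ^t* *m M *m z) 0 0 = f (z *m z ^t*).
    by rewrite fE -[in RHS]mulmxA mxtrace_mulC trace_mx11.
  exact: (PsiP _ (psdmx_mul_adj z) v).
have -> : (Phi \o Ad (u *m v ^t*) \o Psi)%VF
    = \sum_(kl : 'I_n * 'I_n) Ad (col kl.1 W *m (col kl.2 Z) ^t*).
  apply/lfunP=> X; rewrite !comp_lfunE sum_lfunE.
  under eq_bigr do rewrite Ad_rank1.
  rewrite -(pair_bigA _ (fun k l =>
    ((col l Z) ^t* *m X *m col l Z) 0 0 *: (col k W *m (col k W) ^t*))) /=.
  under eq_bigr do rewrite -scaler_suml.
  rewrite -scaler_sumr -mul_tmxC_sum_col -eW Ad_rank1 linearZ; congr (_ *: _).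
  rewrite -/(f X) fE eZ mulmxA mxtrace_mulC mulmxA; apply: eq_bigr => l _.
  by rewrite col_quadratic_form.
by apply: superpositive_sum => -[k l]; apply: rank_le1_mul.
Qed.

(** The entry is the sum over [i] of the squared moduli of [A i p q], so a single nonzero entry of
    some [A i] makes it positive. *)
Lemma superpositive_diag_gt0 (n : nat) (Omega : 'End('M[C]_n)) :
  superpositive_maps Omega -> Omega != 0 ->
  exists p q, 0 < Omega (delta_mx q q) p p.
Proof.
move=> [m [A [_ ->]]].
have diagE i p q : Ad (A i) (delta_mx q q) p p = `|A i p q| ^+ 2.
  rewrite AdE -(mul_delta_mx (0 : 'I_1)) mulmxA -mulmxA -colE -rowE.
  by rewrite !mxE big_ord1 !mxE normCK.
case: (pickP (fun ipq : 'I_m * ('I_n * 'I_n) =>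
  A ipq.1 ipq.2.1 ipq.2.2 != 0)) => [[i [p q]] /= Apq _|A0 /eqP[]]; last first.
  apply: big1 => i _; apply/lfunP => X; rewrite AdE lfunE /=.
  have -> : A i = 0; last by rewrite !mul0mx.
  by apply/matrixP=> p q; have /negbFE/eqP := A0 (i, (p, q)); rewrite mxE.
exists p, q; rewrite sum_lfunE summxE (bigD1 i) //= ltr_pwDl //.
  by rewrite diagE exprn_gt0 // normr_gt0.
by apply: sumr_ge0 => j _; rewrite diagE exprn_ge0.
Qed.

(** * The two inclusions *)

Lemma mapping_cone_superpositive (n : nat) (Omega : 'End('M[C]_n)) :
  Omega != 0 -> superpositive_maps Omega ->
  mapping_cone [set Omega] = @superpositive_maps C n.
Proof.
move=> Omega_neq0 OmegaSP; apply/seteqP; split=> Theta.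
  move=> [m [Phi [Om [Psi [OmE PhiCP PsiCP ->]]]]].
  apply: superpositive_bigsum => i; rewrite (OmE i).
  have [k [A [rkA ->]]] := OmegaSP.
  (* Composition distributes over the sum defining [Omega], which leaves one [Ad (A j)] at a
     time. *)
  have -> : (Phi i \o (\sum_j Ad (A j)) \o Psi i)%VF
      = \sum_j (Phi i \o Ad (A j) \o Psi i)%VF.
    apply/lfunP=> X; rewrite !comp_lfunE !sum_lfunE linear_sum.
    by apply: eq_bigr => j _; rewrite !comp_lfunE.
  apply: superpositive_bigsum => j; apply: superpositive_comp_Ad => //;
    exact: completely_positive_positive.
have [p [q]] := superpositive_diag_gt0 OmegaSP Omega_neq0.
set s := Omega _ _ _ => s_gt0 [m [B [rkB ->]]].
have /fin_all_exists[u /fin_all_exists[v eB]] := fun i => rank_le1_factor (rkB i).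
(* Sandwiching [Omega] between the unscaled maps yields [s] times [Ad (B i)]. The real factor
   [(sqrtC s)^-1] enters [Ad] twice and cancels [s]. *)
exists m, (fun i => Ad (u i *m (delta_mx p 0) ^t*)), (fun=> Omega),
  (fun i => Ad ((sqrtC s)^-1 *: (delta_mx q 0 *m v i ^t*))).
split=> // [i|i|]; try exact: completely_positive_Ad.
apply: eq_bigr => i _; rewrite eB.
apply/lfunP=> X; rewrite !comp_lfunE AdZ scale_lfunE.
rewrite !Ad_rank1 scalerA !linearZ /=.
rewrite !trmx_delta !map_delta_mx mul_delta_mx -scalemxAl -rowE -colE.
have sqrt_conj : Num.conj (sqrtC s)^-1 = (sqrtC s)^-1.
  by apply/CrealP/ger0_real; rewrite invr_ge0 sqrtC_ge0 ltW.
rewrite sqrt_conj !mxE -/s -invfM -expr2 sqrtCK mulrAC mulVf ?mul1r //.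
by rewrite gt_eqF.
Qed.

End Superpositive.

Theorem proposition3 (R : realType) (n : nat) (Omega : 'End('M[R[i]]_n))
    (Omega_neq0 : Omega <> 0)
    (Omega_SP1 : superpositive_maps Omega) :
  mapping_cone [set Omega] = @superpositive_maps R[i] n.
Proof. by apply: mapping_cone_superpositive => //; apply/eqP. Qed.
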